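(* Let $(X,\mathcal{A},\mu)$ be a measure space and let $I$ be an ideal of the ring $\mathcal{M}(X,\mathcal{A})$. For each $f\in I\mu(X,\mathcal{A})$, the map $\Phi_f:\mathbb{R}\to\mathcal{M}(X,\mathcal{A})$, $\Phi_f(r)=r\cdot f$, is continuous when $\mathbb{R}$ has its usual topology and $\mathcal{M}(X,\mathcal{A})$ is given the $m_{\mu_I}$-topology.
   Context: $X$ is a non-empty set, $\mathcal{A}$ a $\sigma$-algebra on $X$, and $\mu:\mathcal{A}\to[0,\infty]$ a measure. $\mathcal{M}(X,\mathcal{A})$ is the commutative ring with unity of all real-valued $\mathcal{A}$-measurable functions on $X$, with pointwise operations. For $g\in\mathcal{M}(X,\mathcal{A})$, $Z(g)=\{x\in X: g(x)=0\}$, and for an ideal $I$, $Z[I]=\{Z(g): g\in I\}$. Null sets $E$ below are always members of $\mathcal{A}$. $I\mu(X,\mathcal{A})$ is the set of all $f\in\mathcal{M}(X,\mathcal{A})$ such that for every $g\in\mathcal{M}(X,\mathcal{A})$ there exist $Z\in Z[I]$ and $E\subseteq Z$ with $\mu(E)=0$ such that $fg$ is bounded on $Z\setminus E$. $U_{\mu_I}^+$ is the set of all $u\in\mathcal{M}(X,\mathcal{A})$ for which there exist $Z\in Z[I]$ and $E\subseteq Z$ with $\mu(E)=0$ such that $u(x)>0$ for all $x\in Z\setminus E$. For $f\in\mathcal{M}(X,\mathcal{A})$ and $u\in U_{\mu_I}^+$, $m_{\mu_I}(f,u)$ is the set of all $g\in\mathcal{M}(X,\mathcal{A})$ for which there exist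 $Z\in Z[I]$ and $E\subseteq Z$ with $\mu(E)=0$ such that $|g(x)-f(x)|<u(x)$ for all $x\in Z\setminus E$. The sets $m_{\mu_I}(f,u)$ ($f\in\mathcal{M}(X,\mathcal{A})$, $u\in U_{\mu_I}^+$) form an open base for a topology on $\mathcal{M}(X,\mathcal{A})$, called the $m_{\mu_I}$-topology. *)

(* Defs.v *)
From HB Require Import structures.
From mathcomp Require Import all_boot all_order all_algebra.
From mathcomp Require Import all_classical all_reals all_analysis.
From mathcomp Require Import measurable_realfun.

Set Implicit Arguments.
Unset Strict Implicit.
Unset Printing Implicit Defensive.

Import Order.TTheory GRing.Theory Num.Theory.
Import numFieldNormedType.Exports.

Local Open Scope classical_set_scope.
Local Open Scope ring_scope.

(* Not the library's [idealr], which is restricted to proper ideals given by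
   boolean predicates: the improper ideal is allowed here. *)
Record ideal (A : comNzRingType) := Ideal {
  ideal_set :> set A ;
  ideal0 : ideal_set 0 ;
  idealD : forall x y, ideal_set x -> ideal_set y -> ideal_set (x + y) ;
  idealMl : forall a x, ideal_set x -> ideal_set (a * x) }.

Section defs.
Context {R : realType} {d : measure_display} {T : measurableType d}.
Variables (mu : {measure set T -> \bar R}) (I : ideal {mfun T >-> R}).

Definition zero_set (g : {mfun T >-> R}) : set T := [set x | g x = 0].

Definition zero_sets : set (set T) := [set zero_set g | g in (I : set _)].

(* The sets Z \ E with Z in Z[I] and E a measurable null subset of Z. *)
Definition conull_zero_sets : set (set T) :=
  [set A | exists Z E, [/\ zero_sets Z, measurable E, E `<=` Z,
     mu E = 0%E & A = Z `\` E]].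

Definition Imu : set {mfun T >-> R} :=
  [set f | forall g : {mfun T >-> R}, exists2 A, conull_zero_sets A &
     [bounded (f x * g x : R^o) | x in A]].

Definition Uplus : set {mfun T >-> R} :=
  [set u | exists2 A, conull_zero_sets A & forall x, A x -> 0 < u x].

Definition mball (f u : {mfun T >-> R}) : set {mfun T >-> R} :=
  [set g | exists2 A, conull_zero_sets A &
     forall x, A x -> `|g x - f x| < u x].

Lemma measurable_zero_set (g : {mfun T >-> R}) : measurable (zero_set g).
Proof.
rewrite (_ : zero_set g = g @^-1` [set 0]); last by [].
by rewrite -[X in measurable X]setTI; exact: measurable_funPT.
Qed.

Lemma zero_setsI (Y Z : set T) :
  zero_sets Y -> zero_sets Z -> zero_sets (Y `&` Z).
Proof.
move=> [g Ig <-] [h Ih <-]; exists (g * g + h * h).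
  by apply: idealD; apply: idealMl.
apply/seteqP; split=> x.
  change (g x ^+ 2 + h x ^+ 2 = 0 -> (zero_set g `&` zero_set h) x) => /eqP.
  by rewrite paddr_eq0 ?sqr_ge0// !sqrf_eq0 => /andP[/eqP gx0 /eqP hx0].
move=> [gx0 hx0]; change (g x ^+ 2 + h x ^+ 2 = 0).
by rewrite gx0 hx0 expr0n addr0.
Qed.

Lemma conull_zero_setsT : conull_zero_sets setT.
Proof.
exists setT, set0; split=> //; last by rewrite setD0.
by exists 0; [exact: ideal0|apply/seteqP; split].
Qed.

Lemma conull_zero_setsI (A B : set T) :
  conull_zero_sets A -> conull_zero_sets B ->
  exists2 C, conull_zero_sets C & C `<=` A `&` B.
Proof.
move=> [Y [E [ZY mE EY E0 ->]]] [Z [F [ZZ mF FZ F0 ->]]].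
exists ((Y `&` Z) `\` ((E `|` F) `&` (Y `&` Z))).
  have mYZ : measurable (Y `&` Z).
    by case: ZY => g _ <-; case: ZZ => h _ <-; apply: measurableI;
      exact: measurable_zero_set.
  have mEF : measurable (E `|` F) by exact: measurableU.
  exists (Y `&` Z), ((E `|` F) `&` (Y `&` Z)); split=> //.
  - exact: zero_setsI.
  - exact: measurableI.
  - have EF0 : mu (E `|` F) = 0%E by rewrite measureU0.
    exact: subset_measure0 (measurableI _ _ mEF mYZ) mEF (@subIsetl _ _ _) EF0.
by move=> x [[Yx Zx] nEF]; split; split=> // ?; apply: nEF; split=> //;
  [left|right].
Qed.

Lemma mball_cover :
  \bigcup_(p in [set p : {mfun T >-> R} * {mfun T >-> R} | Uplus p.2])
    mball p.1 p.2 = setT.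
Proof.
apply/seteqP; split=> // f _; exists (f, 1) => /=.
  by exists setT; [exact: conull_zero_setsT|move=> x _; exact: ltr01].
exists setT; first exact: conull_zero_setsT.
by move=> x _; rewrite subrr normr0; exact: ltr01.
Qed.

Lemma mball_join (f u g v h : {mfun T >-> R}) :
  Uplus u -> Uplus v -> mball f u h -> mball g v h ->
  exists w, [/\ Uplus w, mball h w h &
    mball h w `<=` mball f u `&` mball g v].
Proof.
move=> _ _ [A cA hA] [B cB hB].
pose wf x := Num.min (u x - `|h x - f x|) (v x - `|h x - g x|).
have mwf : measurable_fun setT wf.
  apply: measurable_minr; apply: measurable_funB => //;
    by apply: measurableT_comp => //; exact: measurable_funB.
have [C cC CAB] := conull_zero_setsI cA cB.
pose w : {mfun T >-> R} := mfun_Sub (mem_set mwf).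
have wE x : w x = wf x by [].
have w0 x : C x -> 0 < w x.
  move=> /CAB[Ax Bx]; rewrite wE lt_min !subr_gt0.
  by rewrite hA// hB.
exists w; split.
- by exists C.
- by exists C => // x Cx; rewrite subrr normr0; exact: w0.
move=> k [D cD kD]; have [G cG GCD] := conull_zero_setsI cC cD.
have key x : G x -> `|k x - f x| < u x /\ `|k x - g x| < v x.
  move=> /GCD[Cx Dx]; have := kD _ Dx.
  rewrite wE lt_min !ltrBrDr => /andP[kf kg]; split.
  - by rewrite (le_lt_trans _ kf)// (ler_distD (h x)).
  - by rewrite (le_lt_trans _ kg)// (ler_distD (h x)).
by split; exists G => // x /key[].
Qed.

End defs.

(* A copy of {mfun T >-> R}, carrying the topology with open base the sets
   [mball mu I f u], for u in [Uplus mu I]. *)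
Definition mspace {R : realType} {d : measure_display} {T : measurableType d}
  (mu : {measure set T -> \bar R}) (I : ideal {mfun T >-> R}) : Type :=
  {mfun T >-> R}.

Section mspace_topology.
Context {R : realType} {d : measure_display} {T : measurableType d}.
Variables (mu : {measure set T -> \bar R}) (I : ideal {mfun T >-> R}).
Local Notation M := (mspace mu I).

HB.instance Definition _ := Choice.on M.
HB.instance Definition _ := isPointed.Build M (0 : {mfun T >-> R}).

Let base_index : set (M * M) := [set p | Uplus mu I p.2].
Let base (p : M * M) : set M := mball mu I p.1 p.2.

Let base_cover : \bigcup_(p in base_index) base p = setT.
Proof. exact: mball_cover. Qed.

Let base_join (p q : M * M) (h : M) : base_index p -> base_index q ->
  base p h -> base q h ->
  exists k, [/\ base_index k, base k h & base k `<=` base p `&` base q].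
Proof.
by move=> Up Uq hp hq; have [w] := mball_join Up Uq hp hq; exists (h, w).
Qed.

HB.instance Definition _ := isBaseTopological.Build M base_cover base_join.

End mspace_topology.

(* Main.v *)
Require Import Defs.
From HB Require Import structures.
From mathcomp Require Import all_boot all_order all_algebra.
From mathcomp Require Import all_classical all_reals all_analysis.
From mathcomp Require Import measurable_realfun.
Import Order.TTheory GRing.Theory Num.Theory.
Import numFieldNormedType.Exports.
Local Open Scope classical_set_scope.
Local Open Scope ring_scope.

(** Let [u] be positive on a conull zero set. Since [f] lies in [Imu mu I], its
    product with the measurable function [u^-1] is bounded, say by [M], on a
    conull zero set; on the intersection of the two sets this reads
    [`|f x| < M * u x] ([Imu_dominated]). Hence [`|r - s| <= M^-1] forces
    [`|r * f x - s * f x| < u x] there, i.e. [r *: f] lies in the basic ball of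
    radius [u] around [s *: f]. It suffices to consider balls centred at
    [s *: f] because the basic balls behave as in a metric space: every
    neighbourhood of a point contains one centred at that point
    ([nbhs_mball]). *)

(** A neighbourhood of [h] contains by definition a ball around some [f] that
    has [h] as a member; a ball around [h] itself fits inside, its radius being
    the distance left over. *)
Lemma nbhs_mball (R : realType) (d : measure_display) (T : measurableType d)
    (mu : {measure set T -> \bar R}) (I : ideal {mfun T >-> R})
    (h : mspace mu I) (N : set (mspace mu I)) :
  nbhs h N -> exists2 u, Uplus mu I u & mball mu I h u `<=` N.
Proof.
rewrite nbhsE => -[B [[D Duplus <-] [[f u] Dfu hfu]] BN].
have Uu : Uplus mu I u by exact: (Duplus _ Dfu).
have [w [Uw _ wfu]] := mball_join Uu Uu hfu hfu.
by exists w => // k /wfu[kfu _]; apply: BN; exists (f, u).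
Qed.

(** Boundedness of [f * g] for every measurable [g] is used at a reciprocal of
    [u]. *)
Lemma Imu_dominated (R : realType) (d : measure_display) (T : measurableType d)
    (mu : {measure set T -> \bar R}) (I : ideal {mfun T >-> R})
    (f u : {mfun T >-> R}) :
  Imu mu I f -> Uplus mu I u ->
  exists2 M, 0 < M & exists2 A, conull_zero_sets mu I A &
    forall x, A x -> `|f x| < M * u x.
Proof.
move=> If [A cA u_gt0].
(* The real power is measurable on the whole line, and it agrees with the
   inverse where [u] is positive, the only place where it matters. *)
have mg : measurable_fun setT (fun x => u x `^ (-1)).
  by apply: (measurableT_comp (measurable_powR _)).
pose g : {mfun T >-> R} := mfun_Sub (mem_set mg).
have [B cB /ex_strict_bound_gt0[M M_gt0 fgM]] := If g.
have [C cC CAB] := conull_zero_setsI cA cB.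
exists M => //; exists C => // x /CAB[Ax Bx].
have ux_gt0 := u_gt0 _ Ax.
have gE : g x = (u x)^-1 by rewrite -powR_inv1 ?ltW.
have : `|f x * g x| < M by exact: fgM.
rewrite gE normrM normfV (gtr0_norm ux_gt0).
by rewrite ltr_pdivrMr.
Qed.

Theorem theorem2p4 (R : realType) (d : measure_display) (T : measurableType d)
    (mu : {measure set T -> \bar R}) (I : ideal {mfun T >-> R})
    (f : {mfun T >-> R}) :
  Imu mu I f ->
  continuous ((fun r : R => r *: f) : R -> mspace mu I).
Proof.
move=> If s N /nbhs_mball[u Uu ballN].
have [M M_gt0 [A cA fMu]] := Imu_dominated _ _ _ _ _ _ _ If Uu.
apply/nbhs_ballP; exists M^-1; rewrite /= ?invr_gt0// => r.
rewrite /ball /= distrC => rs; apply: ballN; exists A => // x Ax.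
change (`|r * f x - s * f x| < u x).
rewrite -mulrBl normrM.
apply: (@le_lt_trans _ _ (M^-1 * `|f x|)).
  by apply: ler_wpM2r; [exact: normr_ge0|exact: ltW].
by rewrite mulrC ltr_pdivrMr// mulrC fMu.
Qed.
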